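(* For any integers $m,n$ with $n-1\geq m\geq 0$, $$\sum_{k=1}^n k\,(-1)^k q^{\binom{k}{2}} \left[{n \atop k}\right]_q q^{-mk}=(-1)^{m+1}q^{-\binom{m+1}{2}}(q;q)_m\,(q;q)_{n-m-1}.$$
   Context: $q$ is a complex number with $0<|q|<1$. For an integer $n\ge 0$, $(a;q)_n=\prod_{j=0}^{n-1}(1-aq^j)$ (so $(a;q)_0=1$), and the $q$-binomial coefficient is $\left[{n\atop k}\right]_q=\frac{(q;q)_n}{(q;q)_k(q;q)_{n-k}}$. *)

(* Defs.v *)
From mathcomp Require Import all_boot all_order all_algebra.

Set Implicit Arguments.
Unset Strict Implicit.
Unset Printing Implicit Defensive.

Import GRing.Theory.
Local Open Scope ring_scope.

(* The q-shifted factorial (a; q)_n. *)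
Definition qpoch (F : fieldType) (a q : F) (n : nat) : F :=
  \prod_(0 <= j < n) (1 - a * q ^+ j).

(* The q-binomial coefficient. It is meaningful for k <= n only: n - k is the
   truncated subtraction, so the value is not 0 for k > n. *)
Definition qbinom (F : fieldType) (q : F) (n k : nat) : F :=
  qpoch q q n / (qpoch q q k * qpoch q q (n - k)).

(* Main.v *)
(* By the q-binomial theorem, P(X) = \prod_(j < n) (1 - q^j X) has coefficients
   (-1)^k q^C(k,2) [n, k]_q, so the sum is x P'(x) at x = q^-m. The factor j = m
   of P vanishes at x, hence x P'(x) = - \prod_(j != m) (1 - q^(j-m)). *)
Require Import Defs.
From mathcomp Require Import all_boot all_order all_algebra.
From mathcomp Require Import complex reals.
From mathcomp Require Import ring zify.

Import Order.TTheory GRing.Theory Num.Theory.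
Local Open Scope ring_scope.
Local Open Scope complex_scope.

Section QBinomial.

Context {F : fieldType} (q : F).

Definition qprod_poly (n : nat) : {poly F} :=
  \prod_(0 <= j < n) (1 - q ^+ j *: 'X).

Lemma qpochS (a : F) (n : nat) : qpoch a q n.+1 = qpoch a q n * (1 - a * q ^+ n).
Proof. by rewrite /qpoch big_nat_recr. Qed.

Lemma qpoch0 (a : F) : qpoch a q 0 = 1.
Proof. by rewrite /qpoch big_nil. Qed.

Lemma qprod_polyS (n : nat) :
  qprod_poly n.+1 = qprod_poly n - q ^+ n *: (qprod_poly n * 'X).
Proof. by rewrite /qprod_poly big_nat_recr //= mulrBr mulr1 scalerAr. Qed.

Lemma coefS_qprod_polyS (n k : nat) :
  (qprod_poly n.+1)`_k.+1 = (qprod_poly n)`_k.+1 - q ^+ n * (qprod_poly n)`_k.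
Proof. by rewrite qprod_polyS coefB coefZ coefMX. Qed.

Lemma size_qprod_poly (n : nat) : (size (qprod_poly n) <= n.+1)%N.
Proof.
elim: n => [|n IHn]; first by rewrite /qprod_poly big_nil size_poly1.
rewrite qprod_polyS (leq_trans (size_polyD _ _)) // geq_max size_polyN.
rewrite (leq_trans IHn) //= (leq_trans (size_scale_leq _ _)) //.
by rewrite (leq_trans (size_polyMleq _ _)) // size_polyX addn2.
Qed.

Lemma horner_qprod_poly (n : nat) (x : F) : (qprod_poly n).[x] = qpoch x q n.
Proof.
rewrite /qprod_poly /qpoch horner_prod; apply: eq_bigr => j _.
by rewrite !hornerE mulrC.
Qed.

Section NonRootOfUnity.

Hypothesis q_neq_root1 : forall j, 1 - q * q ^+ j != 0.

Lemma qpoch_neq0 (n : nat) : qpoch q q n != 0.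
Proof. by elim: n => [|n IHn]; rewrite ?qpoch0 ?oner_eq0 // qpochS mulf_neq0. Qed.

Lemma qbinom0 (n : nat) : qbinom q n 0 = 1.
Proof. by rewrite /qbinom qpoch0 mul1r subn0 divff ?qpoch_neq0. Qed.

Lemma qbinomnn (n : nat) : qbinom q n n = 1.
Proof. by rewrite /qbinom subnn qpoch0 mulr1 divff ?qpoch_neq0. Qed.

(** The q-Pascal rule: over a common denominator it is 1 - q^(n+1) = (1 - q^(n-k)) + q^(n-k) (1 -
    q^(k+1)). It fails at k = n, where truncated subtraction makes [qbinom q n n.+1] nonzero. *)
Lemma qbinomS (n k : nat) : (k < n)%N ->
  qbinom q n.+1 k.+1 = qbinom q n k.+1 + q ^+ (n - k) * qbinom q n k.
Proof.
(* Writing n = k + d + 1 removes every truncated subtraction and leaves a rational identity for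
   [field]. *)
move=> ltkn; have [d ->] : exists d, n = (k + d.+1)%N by exists (n - k.+1)%N; lia.
rewrite /qbinom.
have -> : ((k + d.+1).+1 - k.+1)%N = d.+1 by lia.
have -> : (k + d.+1 - k.+1)%N = d by lia.
have -> : (k + d.+1 - k)%N = d.+1 by lia.
have := q_neq_root1 k; have := q_neq_root1 d.
have := qpoch_neq0 k; have := qpoch_neq0 d.
rewrite (qpochS _ (k + d.+1)) (qpochS _ k) (qpochS _ d) exprD !exprS.
by move=> *; field; apply/and4P.
Qed.

(** The q-binomial theorem, by induction on n: multiplying by 1 - q^n X acts on the coefficients as
    the q-Pascal rule, since C(k+1,2) = C(k,2) + k and q^n = q^(n-k) q^k. *)
Lemma coef_qprod_poly (n k : nat) : (k <= n)%N ->
  (qprod_poly n)`_k = (-1) ^+ k * q ^+ 'C(k, 2) * qbinom q n k.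
Proof.
elim: n k => [|n IHn] [|k] // lekn.
- by rewrite /qprod_poly big_nil coef1 qbinom0 !mulr1.
- by rewrite qprod_polyS coefB coefZ coefMX mulr0 subr0 IHn // !qbinom0.
rewrite coefS_qprod_polyS (IHn k) //.
move: lekn; rewrite ltnS leq_eqVlt => /predU1P[->|ltkn].
  (* Top coefficient, out of reach of [qbinomS]: the degree bound kills the first term of the
     recursion, and both q-binomials left equal 1. *)
  rewrite nth_default ?size_qprod_poly // !qbinomnn // binS bin1 exprD [(-1) ^+ _.+1]exprS; ring.
rewrite IHn // qbinomS // binS bin1 exprD [(-1) ^+ _.+1]exprS.
have -> : q ^+ n = q ^+ (n - k) * q ^+ k by rewrite -exprD subnK // ltnW.
ring.
Qed.

Lemma sum_deriv_qprod_poly (n : nat) (x : F) :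
  \sum_(1 <= k < n.+1) k%:R * (-1) ^+ k * q ^+ 'C(k, 2) * qbinom q n k * x ^+ k
  = x * (qprod_poly n)^`().[x].
Proof.
(* Only the bound n on the size of the derivative is used; the sum then has exactly n terms,
   whatever the true degree. *)
rewrite (@horner_coef_wide _ n); last first.
  rewrite (leq_trans (size_poly _ _)) // -subn1 leq_subLR add1n.
  exact: size_qprod_poly.
rewrite big_add1 /= big_mkord mulr_sumr; apply: eq_bigr => k _.
rewrite coef_deriv coef_qprod_poly // [x ^+ _.+1]exprS; ring.
Qed.

End NonRootOfUnity.

Section NonZero.

Hypothesis q_neq0 : q != 0.

(** Read backwards, the factors are 1 - q^(-j) = -q^(-j) (1 - q^j) for j = 1, ..., m, and these j
    add up to C(m+1,2). *)
Lemma qpochVX (m : nat) :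
  qpoch (q ^- m) q m = (-1) ^+ m * q ^- 'C(m.+1, 2) * qpoch q q m.
Proof.
have -> : qpoch (q ^- m) q m = \prod_(0 <= j < m) (1 - q ^- j.+1).
  rewrite /qpoch big_nat_rev; apply: eq_big_nat => j /= ltjm.
  have -> : q ^+ m = q ^+ j.+1 * q ^+ (0 + m - j.+1) by rewrite -exprD subnKC.
  by rewrite invfM mulfVK // expf_neq0.
elim: m => [|m IHm]; first by rewrite big_nil qpoch0 mulr1 divr1.
rewrite big_nat_recr //= IHm qpochS ['C(m.+2, 2)]binS bin1 exprD [(-1) ^+ _.+1]exprS -[q * _]exprS.
have := expf_neq0 m.+1 q_neq0; have := expf_neq0 'C(m.+1, 2) q_neq0.
by move=> *; field; apply/andP.
Qed.

(** In the product rule only the term differentiating the vanishing factor survives. Its derivative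
    -q^m cancels the prefactor q^(-m) up to sign; the factors with j < m and j > m give the two
    q-shifted factorials. *)
Lemma deriv_qprod_poly_at_root (m n : nat) : (m < n)%N ->
  q ^- m * (qprod_poly n)^`().[q ^- m] =
    - (qpoch (q ^- m) q m * qpoch q q (n - m.+1)).
Proof.
move=> ltmn; have qm_neq0 := expf_neq0 m q_neq0.
have -> : qprod_poly n =
    (1 - q ^+ m *: 'X) *
    (qprod_poly m * \prod_(m.+1 <= j < n) (1 - q ^+ j *: 'X)).
  rewrite /qprod_poly (@big_cat_nat _ _ _ m) //= ?(ltnW ltmn) //.
  by rewrite (big_ltn ltmn) mulrCA.
have root_factor : (1 - q ^+ m *: 'X).[q ^- m] = 0.
  by rewrite hornerD hornerN hornerZ hornerX hornerC mulfV ?subrr.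
rewrite derivM hornerD !hornerM root_factor mul0r addr0 derivB derivZ derivX.
rewrite derivC sub0r hornerN hornerZ hornerC mulr1 horner_qprod_poly.
rewrite mulNr mulrN mulrA mulVf // mul1r; congr (- (_ * _)).
(* Shifting j by m + 1 turns each factor 1 - q^j q^(-m) into 1 - q q^j. *)
rewrite horner_prod -{1}[m.+1]add0n big_addn; apply: eq_bigr => j _.
by rewrite !hornerE addnS -addSn exprD mulfK // exprS.
Qed.

End NonZero.

End QBinomial.

Theorem theorem2p2 (R : realType) (q : R[i]) (hq0 : 0 < `|q|) (hq1 : `|q| < 1)
    (m n : nat) (hmn : (m < n)%N) :
  \sum_(1 <= k < n.+1)
     k%:R * (-1) ^+ k * q ^+ 'C(k, 2) * qbinom q n k * q ^- (m * k)
  = (-1) ^+ m.+1 * q ^- 'C(m.+1, 2) * qpoch q q m * qpoch q q (n - m - 1).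
Proof.
have q_neq0 : q != 0 by rewrite -normr_gt0.
have q_neq_root1 j : 1 - q * q ^+ j != 0.
  (* Taking norms, q^(j+1) = 1 would contradict |q| < 1. *)
  rewrite subr_eq0 -exprS; apply/eqP => /(congr1 Num.norm) /eqP.
  by rewrite normr1 normrX eq_sym lt_eqF // exprn_ilt1.
(* This exhibits q^(-mk) as x^k with x = q^(-m). *)
under eq_bigr => k _ do rewrite exprM -exprVn.
rewrite sum_deriv_qprod_poly // deriv_qprod_poly_at_root // qpochVX //.
by rewrite -subnDA addn1 exprS mulN1r !mulNr.
Qed.
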